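(* Let $\Omega\subset\mathbb R^n$ be a properly convex quasi-homogeneous affine domain, and let $L$ be the linear subspace spanned by the asymptotic cone $\mathrm{AC}(\Omega)$. Then $\Omega$ admits a parallel foliation by cosets of its asymptotic cone: for every $x\in\Omega$, the section $\Omega_x=\Omega\cap(x+L)$ is a translate of the asymptotic cone of $\Omega$ (more precisely, $\overline{\Omega_x}=p+\mathrm{AC}(\Omega)$ for some point $p$).
   Context: An affine domain is a connected open subset $\Omega\subset\mathbb R^n$; it is quasi-homogeneous if there are a compact $K\subset\Omega$ and a subgroup $G$ of the group of affine transformations preserving $\Omega$ with $GK=\Omega$. A convex affine domain is properly convex if it contains no complete affine line. The asymptotic cone is $\mathrm{AC}(\Omega)=\{u\in\mathbb R^n\mid x+tu\in\Omega\ \text{for all}\ x\in\Omega,\ t\ge0\}$. *)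

(* Defs.v *)
From HB Require Import structures.
From mathcomp Require Import all_boot all_order all_algebra.
From mathcomp Require Import all_classical all_reals all_analysis.
Set Implicit Arguments. Unset Strict Implicit. Unset Printing Implicit Defensive.
Import Order.TTheory GRing.Theory Num.Theory.
Import numFieldNormedType.Exports.
Local Open Scope classical_set_scope.
Local Open Scope ring_scope.

Section Defs.
Variables (R : realType) (n : nat).
Notation V := 'rV[R]_n.

Definition affine_domain (O : set V) := open O /\ connected O.

Definition convex_set (O : set V) :=
  forall x y t, O x -> O y -> 0 <= t -> t <= 1 -> O ((1 - t) *: x + t *: y).

Definition no_complete_line (O : set V) :=
  ~ exists x u : V, u != 0 /\ forall t : R, O (x + t *: u).

Definition properly_convex (O : set V) := convex_set O /\ no_complete_line O.

Definition affine_transformation (f : V -> V) :=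
  exists (A : 'M[R]_n) (b : V), A \in unitmx /\ forall v, f v = v *m A + b.

Definition affine_subgroup (G : set (V -> V)) :=
  [/\ (forall f, G f -> affine_transformation f),
      G id,
      (forall f g, G f -> G g -> G (f \o g)) &
      (forall f, G f -> exists g, [/\ G g, cancel f g & cancel g f])].

Definition quasi_homogeneous (O : set V) :=
  exists (K : set V) (G : set (V -> V)),
    [/\ compact K, K `<=` O, affine_subgroup G,
        (forall g, G g -> g @` O = O) &
        \bigcup_(g in G) (g @` K) = O].

Definition asymptotic_cone (O : set V) : set V :=
  [set u | forall x t, O x -> 0 <= t -> O (x + t *: u)].

Definition lin_span (S : set V) : set V :=
  [set v | exists (k : nat) (c : 'I_k -> R) (u : 'I_k -> V),
      (forall i, S (u i)) /\ v = \sum_(i < k) c i *: u i].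

End Defs.

(* Main.v *)
Require Import Defs.
From HB Require Import structures.
From mathcomp Require Import all_boot all_order all_algebra perm.
From mathcomp Require Import all_classical all_reals all_analysis.
From mathcomp Require Import ring lra.
Set Implicit Arguments. Unset Strict Implicit. Unset Printing Implicit Defensive.
Import Order.TTheory GRing.Theory Num.Def Num.Theory.
Import numFieldNormedType.Exports.
Local Open Scope classical_set_scope.
Local Open Scope ring_scope.

(** Write [C] for the asymptotic cone, a closed pointed cone with interior in its
    span [L].  On [C] there is a positively homogeneous superadditive function
    [F] that vanishes exactly on the relative boundary of [C] and that every
    linear automorphism of [C] multiplies by a constant.  Given [x] in the
    domain, let [u] maximize [F] over all [c] in [C] such that [x - c] lies in
    the closure of the domain, and put [p = x - u].  Superadditivity makes
    [s u] the maximizer for [y_s = x - (1 - s) u].  Choose symmetries [g_s], with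
    linear parts [A_s], such that [g_s y_s] stays in the compact set [K].  The
    maximizers [s A_s u] of the points [g_s y_s] then stay in a compact subset of
    the interior of [C], so the maps [s A_s] are bounded on [L].  As [s] tends
    to [0] they blow up the section at [p]: if [p + w], with [w] in [L], lies in
    the closure of the domain, every limit of [s A_s w] is an asymptotic
    direction, which forces [w] into [C].  Hence the section lies in [p + C]. *)

(** * Continuity of linear and affine maps, and the entrywise norm *)

Lemma cvg_sumr (K : numFieldType) (V : normedModType K) (T I : Type)
    (F : set_system T) {FF : Filter F} (r : seq I) (f : I -> T -> V)
    (l : I -> V) :
  (forall i, f i x @[x --> F] --> l i) ->
  \sum_(i <- r) f i x @[x --> F] --> \sum_(i <- r) l i.
Proof.
move=> fl; elim: r => [|i r IH].
  rewrite big_nil [X in X @ _](_ : _ = fun=> 0); first exact: cvg_cst.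
  by apply/funext => x; rewrite big_nil.
rewrite big_cons [X in X @ _](_ : _ = fun x => f i x + \sum_(j <- r) f j x).
  exact: cvgD.
by apply/funext => x; rewrite big_cons.
Qed.

Lemma affine_continuous (K : numFieldType) (V : normedModType K) (a : V) (t : K) :
  continuous (fun w : V => a + t *: w).
Proof.
move=> w; apply: cvgD; first exact: cvg_cst.
by apply: cvgZl_tmp; exact: cvg_id.
Qed.

Lemma line_continuous (K : numFieldType) (V : normedModType K) (a b : V) :
  continuous (fun t : K => a + t *: b).
Proof.
move=> t; apply: (@cvgD _ _ _ (nbhs t)); first exact: cvg_cst.
exact: scalel_continuous.
Qed.

Lemma lincomb_continuous (K : numFieldType) (V : normedModType K)
    (T : topologicalType) (f g : T -> V) (s t : K) :
  continuous f -> continuous g -> continuous (fun x => s *: f x + t *: g x).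
Proof.
move=> cf cg x; apply: (@cvgD _ _ _ (nbhs x)).
  by apply: (@cvgZl_tmp _ _ _ (nbhs x)); exact: cf.
by apply: (@cvgZl_tmp _ _ _ (nbhs x)); exact: cg.
Qed.

Lemma cluster_closed (T : topologicalType) (F : set_system T) (A B : set T) z :
  cluster F z -> F A -> closed B -> A `<=` B -> B z.
Proof.
move=> clz FA clB AB; apply: clB; apply: closureS AB _ _.
by move: clz; rewrite clusterE; exact.
Qed.

Lemma mulmxr_continuous (R : realType) (m n : nat) (U : 'M[R]_(m, n)) :
  continuous (fun c : 'rV[R]_m => c *m U).
Proof.
move=> c; rewrite /continuous_at [X in X @ _](_ : _ =
    fun c' : 'rV[R]_m => \sum_i c' 0 i *: row i U); last first.
  by apply/funext => c'; exact: mulmx_sum_row.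
rewrite mulmx_sum_row; apply: (@cvg_sumr R 'rV[R]_n _ _ (nbhs c) _) => i.
by apply: cvgZr_tmp; exact: coord_continuous.
Qed.

Lemma mx_entry_le_norm (R : realType) (m n : nat) (A : 'M[R]_(m, n)) i j :
  `|A i j| <= `|A|.
Proof.
by rewrite [leRHS]/normr/= mx_normrE; apply/bigmax_geP; right; exists (i, j).
Qed.

Lemma mx_norm_le (R : realType) (m n : nat) (A : 'M[R]_(m, n)) (M : R) :
  0 <= M -> (forall i j, `|A i j| <= M) -> `|A| <= M.
Proof.
move=> M0 AM; rewrite /normr/= mx_normrE.
by apply/bigmax_leP; split => // -[i j] _; exact: AM.
Qed.

(** * Open convex sets, their closures and recession directions *)

Section open_convex.
Context (R : realType) (n : nat) (O : set 'rV[R]_n).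
Hypotheses (oO : open O) (cO : Defs.convex_set O).

(** A point [w'] of [O] near [w] replaces [w]. The other endpoint then becomes [f w'], which is
    close to [x] and hence in the open set [O]. *)
Lemma closure_segment (x w : 'rV[R]_n) (t : R) :
  O x -> closure O w -> 0 <= t < 1 -> O ((1 - t) *: x + t *: w).
Proof.
move=> Ox Ow /andP[t0 t1].
have t1n0 : 1 - t != 0 by rewrite subr_eq0 eq_sym lt_eqF.
pose f (w' : 'rV[R]_n) := x + (t / (1 - t)) *: w + (- (t / (1 - t))) *: w'.
have fw : f w = x by rewrite /f scaleNr addrK.
have cf : {for w, continuous f} by exact: affine_continuous.
have : nbhs (f w) O by rewrite fw; apply: open_nbhs_nbhs.
move/cf => /Ow[w' [Ow' Ofw']].
have -> : (1 - t) *: x + t *: w = (1 - t) *: f w' + t *: w'.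
  rewrite /f scaleNr !scalerDr scalerN !scalerA mulrCA divff// mulr1.
  by rewrite subrK.
by apply: cO => //; exact: ltW.
Qed.

Lemma closure_convex : Defs.convex_set (closure O).
Proof.
move=> x y t Ox Oy t0 t1 B.
have cf := @lincomb_continuous R 'rV[R]_n _ fst snd (1 - t) t
  (fun=> cvg_fst) (fun=> cvg_snd) (x, y).
move=> /cf [[P Q] /= [Px Qy] PQ].
have [x' [Ox' Px']] := Ox _ Px; have [y' [Oy' Qy']] := Oy _ Qy.
exists ((1 - t) *: x' + t *: y'); split; first exact: cO.
exact: (PQ (x', y')).
Qed.

(** One ray in the closure suffices: [y + t v] is the limit of points on the segments from [y] to
    [z + (t / e) v] as [e] tends to 0. As the midpoint of [y] and [y + 2 t v], it then lies in [O]
    itself. *)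
Lemma asymptotic_cone_recession (z v : 'rV[R]_n) :
  (forall t, 0 <= t -> closure O (z + t *: v)) -> asymptotic_cone O v.
Proof.
move=> zv.
have yv y t : O y -> 0 <= t -> closure O (y + t *: v).
  move=> Oy t0.
  have cf := cvg_at_right_filter
    (@line_continuous R 'rV[R]_n (y + t *: v) (z - y) 0).
  rewrite scale0r addr0 in cf.
  apply: (closed_cvg _ (@closed_closure _ O) _ _ cf).
  near=> e.
  have e0 : 0 < e by near: e; exact: nbhs_right_gt.
  have e1 : e < 1 by near: e; exact: nbhs_right_lt.
  have -> : y + t *: v + e *: (z - y)
      = (1 - e) *: y + e *: (z + (t / e) *: v).
    by apply/rowP => i; rewrite !mxE; field; rewrite gt_eqF.
  apply: closure_convex; [exact: subset_closure| |exact: ltW|exact: ltW].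
  by apply: zv; rewrite divr_ge0// ltW.
move=> y t Oy t0.
have -> : y + t *: v = (1 - 2^-1) *: y + 2^-1 *: (y + (t * 2) *: v).
  rewrite scalerDr scalerA addrA -scalerDl subrK scale1r; congr (_ + _ *: _).
  by rewrite mulrCA mulVf ?mulr1.
apply: closure_segment => //; last by apply/andP; split; lra.
by apply: yv => //; lra.
Unshelve. all: by end_near. Qed.

Lemma closure_add_asymptotic (z v : 'rV[R]_n) (t : R) :
  asymptotic_cone O v -> closure O z -> 0 <= t -> closure O (z + t *: v).
Proof.
move=> Cv Oz t0 B.
have cf := @affine_continuous R 'rV[R]_n (t *: v) 1 z.
rewrite -[z]scale1r addrC => /cf/Oz[z' [Oz' Bz']].
by exists (t *: v + 1 *: z'); split => //; rewrite scale1r addrC; exact: Cv.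
Qed.

End open_convex.

(** * Closed cones: the asymptotic cone, separation, adapted coordinates *)

Definition closed_cone (R : realType) (n : nat) (C : set 'rV[R]_n) :=
  [/\ closed C, C 0, forall a b, C a -> C b -> C (a + b) &
      forall t a, 0 <= t -> C a -> C (t *: a)].

Lemma asymptotic_cone_closed_cone (R : realType) (n : nat) (O : set 'rV[R]_n) :
  open O -> Defs.convex_set O -> O !=set0 -> closed_cone (asymptotic_cone O).
Proof.
move=> oO cO [x Ox]; split.
- move=> v Cv; apply: (@asymptotic_cone_recession _ _ _ oO cO x) => t t0.
  move=> B; have cf := @affine_continuous R 'rV[R]_n x t v.
  move=> /cf/Cv[v' [Cv' Bv']]; exists (x + t *: v'); split => //.
  exact: Cv'.
- by move=> y t Oy _; rewrite scaler0 addr0.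
- by move=> a b Ca Cb y t Oy t0; rewrite scalerDr addrA; apply/Cb/t0/Ca.
- by move=> t a t0 Ca y s Oy s0; rewrite scalerA; apply: Ca => //; exact: mulr_ge0.
Qed.

Lemma asymptotic_cone_pointed (R : realType) (n : nat) (O : set 'rV[R]_n) v :
  O !=set0 -> no_complete_line O ->
  asymptotic_cone O v -> asymptotic_cone O (- v) -> v = 0.
Proof.
move=> [x Ox] nl Cv CNv; apply: contrapT => /eqP v0; apply: nl.
exists x, v; split => // t; have [t0|t0] := leP 0 t; first exact: Cv.
have := CNv x (- t) Ox; rewrite scalerN scaleNr opprK; apply.
by rewrite oppr_ge0 ltW.
Qed.

(** The first-order condition at a minimum: for negative [a], the step [t = - a / (|b| - a)] would
    make [2 a + t b] at most [a]. *)
Lemma ge0_of_small_quadratic (R : realFieldType) (a b : R) :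
  (forall t, 0 < t <= 1 -> 0 <= t * (2 * a + t * b)) -> 0 <= a.
Proof.
move=> h; rewrite leNgt; apply/negP => a0.
have b1 : 0 < `|b| + - a by rewrite ltr_wpDl// oppr_gt0.
have t0 : 0 < - a / (`|b| + - a) by rewrite divr_gt0// oppr_gt0.
have t1 : - a / (`|b| + - a) <= 1 by rewrite ler_pdivrMr// mul1r lerDr.
have := h _ (introT andP (conj t0 t1)); rewrite pmulr_rge0//.
set t := - a / _ in t0 t1 *.
have : t * b <= - a.
  have : t * b <= t * (`|b| + - a).
    by rewrite ler_pM2l// (le_trans (ler_norm b))// lerDl oppr_ge0 ltW.
  by rewrite [X in _ <= X -> _]mulrAC -mulrA divff ?mulr1// gt_eqF.
lra.
Qed.

(** The functional is the product with [c0 - z], where [c0] is the point of [C] nearest to [z].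
    Small moves from [c0] along any [c] in [C], or along [- c0], stay in [C], so these directions
    have nonnegative value. *)
Lemma closed_cone_separation (R : realType) (d : nat) (C : set 'rV[R]_d) z :
  closed_cone C -> ~ C z ->
  exists h : 'cV[R]_d,
    (forall c, C c -> 0 <= (c *m h) 0 0) /\ (z *m h) 0 0 < 0.
Proof.
move=> [clC C0 CD CZ] Cz.
pose f (c : 'rV[R]_d) := \sum_i (c 0 i - z 0 i) ^+ 2.
have cf : continuous f.
  move=> c; apply: (@cvg_sumr R R _ _ (nbhs c)) => i.
  have cg : {for c, continuous (fun c' : 'rV[R]_d => c' 0 i - z 0 i)}.
    by apply: (@cvgB R R _ (nbhs c)); [exact: coord_continuous|exact: cvg_cst].
  exact: (@cvgM R _ (nbhs c) _ _ _ _ _ cg cg).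
pose A := C `&` [set c | f c <= f 0].
have clA : closed A.
  apply: closedI => //.
  by apply: (@preimage_closed _ _ f [set x | x <= f 0]) => //; exact: closed_le.
have cA : compact A.
  apply: bounded_closed_compact => //.
  exists (`|z| + f 0 + 1); split; first exact: num_real.
  move=> M ltM c [_ /= fc].
  have f0 : 0 <= f 0 by apply: sumr_ge0 => i _; exact: sqr_ge0.
  have M0 : 0 <= M by apply: le_trans (ltW ltM); rewrite !addr_ge0.
  apply: mx_norm_le => // i j; rewrite ord1; apply: le_trans (ltW ltM).
  have -> : c 0 j = z 0 j + (c 0 j - z 0 j) by rewrite addrC subrK.
  apply: le_trans (ler_normD _ _) _; rewrite -addrA lerD ?mx_entry_le_norm//.
  have : (c 0 j - z 0 j) ^+ 2 <= f 0.
    apply: le_trans fc; rewrite /f (bigD1 j)//= lerDl.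
    by apply: sumr_ge0 => k _; exact: sqr_ge0.
  rewrite -real_normK ?num_real//; set y := `| _ |; move=> yy.
  by have := sqr_ge0 (y - 1); rewrite sqrrB expr1n; nra.
have [||c0 /set_mem[Cc0 fc0] minA] := @compact_EVT_min _ _ f A _ cA.
- by exists 0; split => //=.
- exact: continuous_subspaceT.
have minC c : C c -> f c0 <= f c.
  move=> Cc; have [fc|fc] := leP (f c) (f 0); first by apply: minA; apply/mem_set.
  by apply: le_trans fc0 (ltW fc).
pose h : 'cV[R]_d := (c0 - z)^T.
have dotE a : (a *m h) 0 0 = \sum_i a 0 i * (c0 0 i - z 0 i).
  by rewrite mxE; apply: eq_bigr => i _; rewrite !mxE.
have dir e : (forall t, 0 < t <= 1 -> C (c0 + t *: e)) -> 0 <= (e *m h) 0 0.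
  move=> Ce; apply: (@ge0_of_small_quadratic _ _ (\sum_i e 0 i ^+ 2)) => t t01.
  have := minC _ (Ce t t01); rewrite -subr_ge0; congr (0 <= _).
  rewrite dotE /f -sumrB mulrDr mulrA !mulr_sumr -big_split/=.
  by apply: eq_bigr => i _; rewrite !mxE; ring.
exists h; split => [c Cc|].
  by apply: dir => t /andP[t0 _]; apply: CD => //; apply: CZ => //; exact: ltW.
have : 0 <= ((- c0) *m h) 0 0.
  apply: dir => t /andP[_ t1].
  by rewrite scalerN -{1}[c0]scale1r -scalerBl; apply: CZ => //; rewrite subr_ge0.
have -> : z = c0 - (c0 - z) by rewrite opprB addrC subrK.
rewrite mulmxBl mulNmx [X in 0 <= X -> _]mxE [X in _ -> X < _]mxE oppr_ge0.
rewrite [X in _ -> _ + X < _]mxE.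
suff : 0 < ((c0 - z) *m h) 0 0 by lra.
rewrite dotE lt0r sumr_ge0 ?andbT; last first.
  by move=> i _; rewrite !mxE -expr2 sqr_ge0.
apply/negP; rewrite psumr_eq0; last by move=> i _; rewrite !mxE -expr2 sqr_ge0.
move=> /allP e0; apply: Cz; suff -> : z = c0 by [].
apply/rowP => i; have := e0 i (mem_index_enum i).
by rewrite !mxE mulf_eq0 orbb subr_eq0 => /eqP.
Qed.

(** Extracts a basis from a possibly infinite set, here a cone and then its dual cone: a vector
    outside the row space of a largest independent family could be added to it. *)
Lemma maximal_row_free (F : fieldType) (n : nat) (S : set 'rV[F]_n) :
  exists r (W : 'M[F]_(r, n)),
    [/\ row_free W, forall i, S (row i W) & forall s, S s -> (s <= W)%MS].
Proof.
pose P r := `[< exists W : 'M[F]_(r, n), row_free W /\ forall i, S (row i W) >].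
have P0 : exists r, P r.
  exists 0; apply/asboolP; exists 0; split; last by case.
  by rewrite /row_free mxrank0.
have Pn r : P r -> (r <= n)%N.
  by move=> /asboolP[W [/eqP rW _]]; rewrite -[leqLHS]rW rank_leq_col.
case: (ex_maxnP P0 Pn) => r /asboolP[W [fW SW]] rmax.
exists r, W; split => // s Ss; apply: contrapT => /negP sW.
suff : P (1 + r)%N by move/rmax; rewrite add1n ltnn.
apply/asboolP; exists (col_mx s W); split; last first.
  move=> i; case: (split_ordP i) => j ->; first by rewrite rowKu row_id.
  by rewrite rowKd.
rewrite /row_free eqn_leq rank_leq_row -addsmxE add1n -{1}(eqP fW).
apply: rank_ltmx; rewrite ltmxE addsmxSr/=.
by apply: contra sW => /(submx_trans (addsmxSl s W)).
Qed.

(** The dual of a pointed closed cone spans the dual space, so a basis of dual functionals gives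
    coordinates that are nonnegative on the cone. *)
Lemma closed_cone_coordinates (R : realType) (n : nat) (C : set 'rV[R]_n) :
  closed_cone C -> (forall v, C v -> C (- v) -> v = 0) ->
  exists d (U : 'M[R]_(d, n)),
    [/\ row_free U, lin_span C = [set c *m U | c in [set: 'rV[R]_d]],
        forall c, C (c *m U) -> forall i, 0 <= c 0 i &
        exists e : 'rV[R]_d, nbhs e [set c | C (c *m U)]].
Proof.
move=> [clC C0 CD CZ] pC.
have [d [U0 [fU0 CU0 maxU0]]] := maximal_row_free C.
pose D := [set c : 'rV[R]_d | C (c *m U0)].
have coneD : closed_cone D.
  split; first by apply: preimage_closed => // x _; exact: mulmxr_continuous.
  - by rewrite /D/= mul0mx.
  - by move=> a b Da Db; rewrite /D/= mulmxDl; exact: CD.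
  - by move=> t a t0 Da; rewrite /D/= -scalemxAl; exact: CZ.
have pD v : D v -> D (- v) -> v = 0.
  rewrite /D/= mulNmx => Dv DNv; apply: (row_free_inj fU0).
  by rewrite mul0mx; exact: pC.
have [r [W [fW dualW maxW]]] := maximal_row_free
  [set h : 'rV[R]_d | forall c, D c -> 0 <= (c *m h^T) 0 0].
(* A nonzero [v] killed by all dual functionals would, by separation, lie in the cone together with
   [- v]. *)
have rd : r = d.
  have rW : \rank W = r by apply/eqP.
  apply/eqP; rewrite eqn_leq -{1}rW rank_leq_col/= leqNgt; apply/negP => rltd.
  have : kermx W^T != 0.
    by rewrite -mxrank_eq0 mxrank_ker mxrank_tr rW subn_eq0 -ltnNge.
  move=> /rowV0Pn[v /sub_kermxP vW v0].
  have perp (h : 'cV[R]_d) : (forall c, D c -> 0 <= (c *m h) 0 0) -> v *m h = 0.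
    move=> Dh; have /maxW/submxP[x hx] :
        [set h : 'rV[R]_d | forall c, D c -> 0 <= (c *m h^T) 0 0] h^T.
      by move=> c /=; rewrite trmxK; exact: Dh.
    by rewrite -[h]trmxK hx trmx_mul mulmxA vW mul0mx.
  have memD w : (forall h : 'cV[R]_d, v *m h = 0 -> w *m h = 0) -> D w.
    move=> wh; apply: contrapT => /(closed_cone_separation coneD)[h [Dh]].
    by rewrite wh ?perp// mxE ltxx.
  move/eqP: v0; apply; apply: pD; apply: memD => // h.
  by rewrite mulNmx => ->; rewrite oppr0.
subst r.
have uW : W^T \in unitmx by rewrite unitmx_tr -row_free_unit.
(* In the basis [U] the i-th coordinate is the value of the dual functional [row i W]. *)
pose U := invmx W^T *m U0.
have UU0 : (U :=: U0)%MS.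
  by apply: eqmxMfull; rewrite row_full_unit unitmx_inv.
exists d, U; split.
- by rewrite /row_free UU0.
- apply/seteqP; split => v.
  + move=> [k [c [u [Cu ->]]]].
    have : ((\sum_(i < k) c i *: u i)%R <= U)%MS.
      by apply: summx_sub => i _; apply: scalemx_sub; rewrite UU0; exact: maxU0.
    by move=> /submxP[x ->]; exists x.
  + move=> [c _ <-]; exists d, (fun i => (c *m invmx W^T) 0 i), (fun i => row i U0).
    by split => //; rewrite mulmxA mulmx_sum_row.
- move=> c; rewrite mulmxA => Dc i.
  by have := dualW i _ Dc; rewrite tr_row colE mulmxA mulmxKV// -colE mxE.
(* This is the sum of the basis [U0] of cone vectors: within distance 1 of [const_mx 1], all
   coordinates in [U0] are positive. *)
- exists (const_mx 1 *m W^T).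
  have : nbhs (const_mx 1 : 'rV[R]_d) D.
    apply/nbhs_ballP; exists 1 => //= c; rewrite -ball_normE /= => c1.
    rewrite /D/= mulmx_sum_row; elim/big_ind : _ => // i _; apply: CZ => //.
    have := le_lt_trans (mx_entry_le_norm (const_mx 1 - c) 0 i) c1.
    by rewrite !mxE ltr_norml; lra.
  have -> : [set c | C (c *m U)] = (fun c => c *m invmx W^T) @^-1` D.
    by apply/funext => c; rewrite /D/= mulmxA.
  by rewrite -{1}[const_mx 1](mulmxK uW) => /(@mulmxr_continuous _ _ _ (invmx W^T)).
Qed.

(** * Determinant estimates and the height function of a cone *)

Lemma det_norm_le (R : realType) (d : nat) (X : 'M[R]_d) (M : R) :
  (forall i j, `|X i j| <= M) -> `|\det X| <= d`!%:R * M ^+ d.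
Proof.
move=> XM; rewrite /determinant; apply: le_trans (ler_norm_sum _ _ _) _.
apply: (@le_trans _ _ (\sum_(s : 'S_d) M ^+ d)); last first.
  by rewrite sumr_const card_Sn mulr_natl.
apply: ler_sum => s _; rewrite normrM normrX normrN1 expr1n mul1r normr_prod.
rewrite -[X in _ ^+ X](card_ord d) -prodr_const.
by apply: ler_prod => i _; rewrite normr_ge0 XM.
Qed.

Lemma det_scalar_col (R : comNzRingType) (d : nat) (i : 'I_d) (r : R)
    (h : 'cV[R]_d) :
  \det (\matrix_(j, k) if k == i then h j 0 else r *+ (j == k))
  = h i 0 * r ^+ d.-1.
Proof.
rewrite (expand_det_row _ i) (bigD1 i)//= mxE eqxx big1 ?addr0; last first.
  by move=> k /negbTE ki; rewrite mxE ki eq_sym ki mul0r.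
rewrite /cofactor addnn -signr_odd odd_double expr0 mul1r; congr (_ * _).
rewrite -det_scalar; congr (\det _); apply/matrixP => j k.
by rewrite !mxE eq_sym (negbTE (neq_lift _ _)) (inj_eq lift_inj).
Qed.

Section cone_height.
Context (R : realType) (d : nat) (C : set 'rV[R]_d).
Hypotheses (coneC : closed_cone C) (C_ge0 : forall c, C c -> forall i, 0 <= c 0 i).

Definition cone_frame (X : 'M[R]_d) :=
  1 <= `|\det X| /\ forall c, C c -> forall i, 0 <= (c *m X) 0 i.

(* The frames are the coordinate systems, of determinant at least 1, that are
   nonnegative on [C].  An automorphism [A] of [C] permutes them up to scaling by
   [|det A| ^ (1 / d)], hence scales the height by that factor. *)
Definition cone_height (u : 'rV[R]_d) : R :=
  inf [set \sum_i (u *m X) 0 i | X in cone_frame].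

Lemma cone_frame1 : cone_frame 1%:M.
Proof. by split => [|c Cc i]; [rewrite det1 normr1|rewrite mulmx1; exact: C_ge0]. Qed.

Lemma cone_height_le u X : C u -> cone_frame X ->
  cone_height u <= \sum_i (u *m X) 0 i.
Proof.
move=> Cu fX; apply: ge_inf; last by exists X.
by exists 0 => _ [Y [_ fY] <-]; apply: sumr_ge0 => i _; exact: fY.
Qed.

Lemma le_cone_height u (m : R) :
  (forall X, cone_frame X -> m <= \sum_i (u *m X) 0 i) -> m <= cone_height u.
Proof.
move=> mX; apply: lb_le_inf.
  by exists (\sum_i (u *m 1%:M) 0 i), 1%:M => //; exact: cone_frame1.
by move=> _ [X fX <-]; exact: mX.
Qed.

Lemma cone_heightD a b : C a -> C b ->
  cone_height a + cone_height b <= cone_height (a + b).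
Proof.
move=> Ca Cb; apply: le_cone_height => X fX; rewrite mulmxDl.
under eq_bigr do rewrite mxE.
by rewrite big_split lerD// cone_height_le.
Qed.

Lemma cone_heightZ t u : 0 <= t -> C u -> t * cone_height u <= cone_height (t *: u).
Proof.
move=> t0 Cu; apply: le_cone_height => X fX; rewrite -scalemxAl.
under eq_bigr do rewrite mxE.
by rewrite -mulr_sumr ler_wpM2l// cone_height_le.
Qed.

(** If [X] is a frame then so is [t^-1 A X]: [A] preserves [C], and the bound on [t ^+ d] keeps the
    determinant at least 1 in absolute value. *)
Lemma cone_height_mulmx (A : 'M[R]_d) (t : R) u : 0 < t -> t ^+ d <= `|\det A| ->
  (forall c, C c -> C (c *m A)) -> C u ->
  t * cone_height u <= cone_height (u *m A).
Proof.
move=> t0 tA CA Cu; apply: le_cone_height => X [detX fX].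
rewrite mulrC -ler_pdivlMr// mulrC.
have -> : t^-1 * (\sum_i (u *m A *m X) 0 i)
    = \sum_i (u *m (t^-1 *: (A *m X))) 0 i.
  by rewrite mulr_sumr; apply: eq_bigr => i _; rewrite -scalemxAr mulmxA [RHS]mxE.
apply: cone_height_le => //; split => [|c Cc i].
  rewrite detZ det_mulmx !normrM normrX ger0_norm ?invr_ge0 ?(ltW t0)//.
  by rewrite exprVn mulrA mulr_ege1// mulrC ler_pdivlMr ?exprn_gt0// mul1r.
rewrite -scalemxAr mulmxA mxE mulr_ge0 ?invr_ge0 ?(ltW t0)//.
by apply: fX; exact: CA.
Qed.

Lemma cone_height_unitmx (A : 'M[R]_d) : (0 < d)%N -> A \in unitmx ->
  (forall c, C c -> C (c *m A)) -> (forall c, C c -> C (c *m invmx A)) ->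
  exists2 t : R, 0 < t & forall u, C u -> cone_height (u *m A) = t * cone_height u.
Proof.
move=> d0 uA CA CAV.
have detA : 0 < `|\det A| by rewrite normr_gt0 -unitfE -unitmxE.
pose t := `|\det A| `^ d%:R^-1.
have t0 : 0 < t by exact: powR_gt0.
have td : t ^+ d = `|\det A|.
  by rewrite /t -powR_mulrn ?powR_ge0// -powRrM mulVf ?powRr1 ?pnatr_eq0 -?lt0n.
exists t => // u Cu; apply/eqP; rewrite eq_le cone_height_mulmx ?td// andbT.
rewrite -ler_pdivrMl// -{2}[u](mulmxK uA) cone_height_mulmx ?invr_gt0//.
- by rewrite det_inv normfV exprVn td.
- exact: CA.
Qed.

(** An infimum of continuous functions is upper semicontinuous: its superlevel sets are
    intersections of closed sets. *)
Lemma closed_cone_height_ge (m : R) : closed [set u | C u /\ m <= cone_height u].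
Proof.
have -> : [set u | C u /\ m <= cone_height u] = C `&`
    \bigcap_(X in cone_frame) [set u | m <= \sum_i (u *m X) 0 i].
  apply/seteqP; split => u /= [Cu mu]; split => //.
    by move=> X fX /=; apply: le_trans mu (cone_height_le _ _).
  by apply: le_cone_height => X /mu.
case: coneC => clC _ _ _; apply: closedI => //; apply: closed_bigI => X _.
apply: (@preimage_closed _ _ (fun u : 'rV[R]_d => \sum_i (u *m X) 0 i)
  [set x | m <= x]); last exact: closed_ge.
move=> u _; apply: (@cvg_sumr R R _ _ (nbhs u)) => i.
apply: (@continuous_comp _ _ _ (fun u : 'rV[R]_d => u *m X) (fun v => v 0 i)).
  exact: mulmxr_continuous.
exact: coord_continuous.
Qed.

(** Upper semicontinuity suffices: points of nearly maximal height cluster in the compact set, and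
    superlevel sets are closed. *)
Lemma cone_height_max (A : set 'rV[R]_d) : compact A -> A !=set0 -> A `<=` C ->
  exists2 u, A u & forall c, A c -> cone_height c <= cone_height u.
Proof.
move=> cA A0 AC; pose B := cone_height @` A; pose s := sup B.
have hB : has_sup B.
  split; first exact: image_nonempty.
  have [M M0 AM] := ex_strict_bound_gt0 (compact_bounded cA).
  exists (\sum_(i < d) M) => _ [u Au <-].
  apply: le_trans (cone_height_le (AC _ Au) cone_frame1) _.
  rewrite mulmx1; apply: ler_sum => i _; apply: le_trans (ler_norm _) _.
  exact: le_trans (mx_entry_le_norm _ _ _) (ltW (AM _ Au)).
pose F := filter_from [set e : R | 0 < e]
  (fun e => A `&` [set u | s - e <= cone_height u]).
have FF : ProperFilter F.
  apply: filter_from_proper; last first.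
    move=> e e0; have [_ [u Au <-] su] := sup_adherent e0 hB.
    by exists u; split => //=; exact: ltW.
  apply: filter_from_filter; first by exists 1 => /=.
  move=> e e' e0 e'0; exists (minr e e') => /=; first by rewrite lt_min e0.
  move=> u [Au /= su]; split; split => //=; apply: le_trans su.
    by rewrite lerB// ge_min lexx.
  by rewrite lerB// ge_min lexx orbT.
have [|u [Au clu]] := cA F FF.
  by exists 1 => //= u [].
exists u => // c Ac; apply: (@le_trans _ _ s).
  by apply: ub_le_sup; [case: hB|exists c].
apply/ler_addgt0Pr => e e0; rewrite -lerBlDr.
have [] // : [set u | C u /\ s - e <= cone_height u] u.
apply: closed_cone_height_ge; move: clu; rewrite clusterE.
move=> /(_ (A `&` [set u | s - e <= cone_height u])) clu.
apply: closureS (clu _) => [v [Av sv]|]; last by exists e.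
by split => //; exact: AC.
Qed.

(* A functional that is nonnegative on [C] and almost vanishes at [u] completes
   to a frame in which [u] has small coordinate sum. *)
Lemma cone_height_gt0_interior u : C u -> 0 < cone_height u -> nbhs u C.
Proof.
move=> Cu; set m := cone_height u => m0; pose S := \sum_i u 0 i.
have S0 : 0 <= S by apply: sumr_ge0 => i _; exact: C_ge0.
(* The coordinates scaled by [r] will contribute at most [r S < m], the factor [t] brings the
   determinant back to absolute value 1, and the radius [e] keeps [d e t] below [m - r S]. *)
pose r := m / (2 * (S + 1)).
have r0 : 0 < r by rewrite divr_gt0// mulr_gt0// ltr_wpDl.
have rS : r * S < m.
  have : r * (2 * (S + 1)) = m by rewrite divfK// gt_eqF// mulr_gt0// ltr_wpDl.
  by nra.
pose t := (r ^+ d.-1)^-1.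
have t0 : 0 < t by rewrite invr_gt0 exprn_gt0.
pose e := (m - r * S) / (t * (d%:R + 1)).
have e0 : 0 < e by rewrite divr_gt0 ?subr_gt0// mulr_gt0// ltr_wpDl.
apply/nbhs_ballP; exists e => //= w; rewrite -ball_normE /= => uw.
apply: contrapT => /(closed_cone_separation coneC)[h [Ch wh]].
have : mx_norm h != 0.
  by apply/eqP => /mx_norm_eq0 h0; move: wh; rewrite h0 mulmx0 mxE ltxx.
(* The index [i] is where [h] has its largest entry in absolute value, so no entry of [g] exceeds
   [t] in absolute value. *)
move=> /[dup] h0 /mx_norm_neq0[[i i']]; rewrite /= ord1 => hi.
have {h0} hi0 : 0 < `|h i 0| by rewrite -hi lt0r h0 hi normr_ge0.
pose g := (t / `|h i 0|) *: h.
have th0 : 0 < t / `|h i 0| by rewrite divr_gt0.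
pose X : 'M[R]_d := \matrix_(j, k) if k == i then g j 0 else r *+ (j == k).
have XE c k : (c *m X) 0 k = if k == i then (c *m g) 0 0 else r * c 0 k.
  rewrite mxE; have [ki|ki] := boolP (k == i).
    by rewrite mxE; apply: eq_bigr => j _; rewrite mxE ki.
  rewrite (bigD1 k)//= mxE (negbTE ki) eqxx mulr1n big1 ?addr0 1?mulrC// => j jk.
  by rewrite mxE (negbTE ki) (negbTE jk) mulr0.
have gE c : (c *m g) 0 0 = t / `|h i 0| * (c *m h) 0 0.
  by rewrite -scalemxAr mxE.
have fX : cone_frame X.
  split => [|c Cc k].
    rewrite det_scalar_col mxE !normrM (gtr0_norm t0) normfV normr_id.
    rewrite divfK ?gt_eqF// normrX (gtr0_norm r0) mulVf//.
    by rewrite gt_eqF// exprn_gt0.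
  rewrite XE; case: ifP => _; last by rewrite mulr_ge0 ?C_ge0// ltW.
  by rewrite gE mulr_ge0 ?Ch// ltW.
have := cone_height_le Cu fX; apply/negP; rewrite -ltNge.
rewrite (bigD1 i)//= XE eqxx.
have le1 : \sum_(k | k != i) (u *m X) 0 k <= r * S.
  rewrite /S mulr_sumr [leRHS](bigD1 i)//= -[leLHS]add0r.
  apply: lerD; first by rewrite mulr_ge0 ?C_ge0// ltW.
  by apply: ler_sum => k /negbTE ki; rewrite XE ki.
have le2 : (u *m g) 0 0 < m - r * S.
  rewrite -[u](subrK w) mulmxDl mxE.
  have wg : (w *m g) 0 0 < 0 by rewrite gE pmulr_rlt0.
  suff : ((u - w) *m g) 0 0 <= m - r * S by lra.
  apply: (@le_trans _ _ (\sum_(j < d) e * t)).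
    rewrite mxE; apply: ler_sum => j _; apply: le_trans (ler_norm _) _.
    rewrite normrM ler_pM//; first exact: le_trans (mx_entry_le_norm _ _ _) (ltW uw).
    rewrite mxE normrM gtr0_norm// -mulrA ger_pMr// mulrC ler_pdivrMr// mul1r.
    by rewrite -hi; exact: (mx_entry_le_norm h).
  rewrite sumr_const card_ord -mulr_natl /e.
  rewrite mulrA mulrAC
    [X in X <= _](_ : _ = (m - r * S) * (d%:R / (d%:R + 1))); last first.
    by field; rewrite !gt_eqF// ltr_wpDl.
  by rewrite ger_pMr ?subr_gt0// ler_pdivrMr ?mul1r ?lerDl// ltr_wpDl.
by rewrite -/m; lra.
Qed.

(** If [u] had too small a coordinate sum in a frame, nonnegativity at the points of [C] obtained
    from [u] by steps of length [r] along the axes would bound all entries by [1 / N]. The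
    determinant would then be at most [d! / N ^ d], which is less than 1. *)
Lemma interior_cone_height_gt0 u : (0 < d)%N -> nbhs u C -> 0 < cone_height u.
Proof.
move=> d0 nu; have Cu := nbhs_singleton nu.
move: nu => /nbhs_ballP[e /= e0 eC].
pose r := e / 2; have r0 : 0 < r by rewrite divr_gt0.
pose N : R := d`!%:R + 1; have N0 : 0 < N by rewrite ltr_wpDl.
apply: (@lt_le_trans _ _ (r / N)); first by rewrite divr_gt0.
apply: le_cone_height => X [detX fX]; rewrite leNgt; apply/negP => uX.
have C1 j (s : R) : `|s| = r -> C (u + s *: delta_mx 0 j).
  move=> sr; apply: eC; rewrite -ball_normE /= opprD addrA subrr add0r normrN.
  rewrite normrZ sr; apply: (@le_lt_trans _ _ (r * 1)).
    rewrite ler_pM2l//; apply: mx_norm_le => // i k.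
    by rewrite mxE; case: (_ && _); rewrite ?normr1 ?normr0.
  by rewrite mulr1 /r; lra.
have XM j k : `|X j k| <= N^-1.
  have h s : `|s| = r -> 0 <= (u *m X) 0 k + s * X j k.
    move=> /(C1 j)/fX/(_ k); rewrite mulmxDl -scalemxAl -rowE.
    by congr (0 <= _); rewrite mxE; congr (_ + _); rewrite !mxE.
  have uk : (u *m X) 0 k <= r / N.
    apply: le_trans (ltW uX); rewrite (bigD1 k)//= lerDl.
    by apply: sumr_ge0 => i _; exact: fX.
  have := h r (gtr0_norm r0).
  have := h (- r); rewrite normrN gtr0_norm// => /(_ erefl).
  rewrite mulNr => h1 h2; rewrite ler_norml -(ler_pM2l r0) -[X in _ && X](ler_pM2l r0).
  by rewrite mulrN; apply/andP; split; lra.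
have := le_trans detX (det_norm_le XM); apply/negP; rewrite -ltNge exprVn.
rewrite ltr_pdivrMr ?exprn_gt0// mul1r.
apply: (@lt_le_trans _ _ N); first by rewrite ltrDl.
by rewrite ler_eXnr// /N lerDr.
Qed.

End cone_height.

(** * Sections of a quasi-homogeneous domain: lower sets, symmetries, blow-up *)

Section quasi_homogeneous_section.
Context (R : realType) (n d : nat) (O : set 'rV[R]_n) (U : 'M[R]_(d, n)).
Hypotheses (oO : open O) (cO : Defs.convex_set O) (O0 : O !=set0).
Hypothesis nlO : no_complete_line O.
Hypothesis fU : row_free U.
Hypothesis spanU :
  lin_span (asymptotic_cone O) = [set c *m U | c in [set: 'rV[R]_d]].

Let C := [set c : 'rV[R]_d | asymptotic_cone O (c *m U)].
Hypothesis C_ge0 : forall c, C c -> forall i, 0 <= c 0 i.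

Let coneC : closed_cone C.
Proof.
have [clA A0 AD AZ] := asymptotic_cone_closed_cone oO cO O0.
split; first by apply: preimage_closed => // x _; exact: mulmxr_continuous.
- by rewrite /C/= mul0mx.
- by move=> a b Ca Cb; rewrite /C/= mulmxDl; exact: AD.
- by move=> t a t0 Ca; rewrite /C/= -scalemxAl; exact: AZ.
Qed.

Lemma asymptotic_cone_mulmx v : asymptotic_cone O v -> exists c, v = c *m U.
Proof.
move=> Cv; have : lin_span (asymptotic_cone O) v.
  exists 1%N, (fun=> 1), (fun=> v); split => //.
  by rewrite big_ord1 scale1r.
by rewrite spanU => -[c _ <-]; exists c.
Qed.

Definition lower_set (y : 'rV[R]_n) : set 'rV[R]_d :=
  [set c | C c /\ closure O (y - c *m U)].

(** Otherwise, for every [M], some [k - M c] with [k] in [K] and [c] a unit vector of [C] lies in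
    the closure. At a cluster point the whole ray [k - t c] does, so [- c] is asymptotic too,
    against pointedness. *)
Lemma lower_set_bounded (K : set 'rV[R]_n) : compact K -> K `<=` O ->
  exists2 M : R, 0 < M & forall k c, K k -> lower_set k c -> `|c| <= M.
Proof.
move=> cK KO; apply: contrapT => unb.
pose S := C `&` [set c | `|c| = 1].
have cS : compact S.
  apply: bounded_closed_compact.
    exists 1; split; first exact: num_real.
    by move=> M M1 c [_ /= ->]; exact: ltW.
  case: coneC => clC _ _ _; apply: closedI => //.
  apply: (@preimage_closed _ _ (fun c : 'rV[R]_d => `|c|) [set x | x = 1]).
    by move=> c _; exact: norm_continuous.
  exact: closed_eq.
(* By convexity towards [k], the sets [E M] shrink as [M] grows and form a filter base. *)
pose E (M : R) := (K `*` S) `&` [set z | closure O (z.1 - (M *: z.2) *m U)].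
pose F := filter_from [set M : R | 0 < M] E.
have FF : ProperFilter F.
  apply: filter_from_proper; last first.
    move=> M M0; apply: contrapT => EM0; apply: unb; exists M => // k c Kk [Cc kc].
    rewrite leNgt; apply/negP => Mc.
    have c0 : 0 < `|c| by exact: lt_trans Mc.
    apply: EM0; exists (k, `|c|^-1 *: c); split; first split => //=; first split.
    - by case: coneC => _ _ _; apply => //; rewrite invr_ge0.
    - by rewrite /= normrZ normfV normr_id mulVf// gt_eqF.
    - rewrite /=; have -> : k - (M *: (`|c|^-1 *: c)) *m U
          = (1 - M / `|c|) *: k + (M / `|c|) *: (k - c *m U).
        rewrite scalerA -scalemxAl scalerBr addrA -scalerDl subrK.
        by rewrite scale1r.
      apply: closure_convex => //; first exact/subset_closure/KO.
        by rewrite divr_ge0// ltW.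
      by rewrite ler_pdivrMr// mul1r ltW.
  apply: filter_from_filter; first by exists 1 => /=.
  move=> M M' M0 M'0; exists (maxr M M') => /=; first by rewrite lt_max M0.
  have mono (N N' : R) : 0 < N -> N <= N' -> E N' `<=` E N.
    move=> N0 NN' [k c] [[Kk Sc] /= kc]; split => //=.
    have N'0 : 0 < N' by exact: lt_le_trans NN'.
    have -> : k - (N *: c) *m U
        = (1 - N / N') *: k + (N / N') *: (k - (N' *: c) *m U).
      rewrite -!scalemxAl scalerBr addrA -scalerDl subrK scale1r scalerA.
      by rewrite divfK// gt_eqF.
    apply: closure_convex => //; first exact/subset_closure/KO.
      by rewrite divr_ge0// ltW.
    by rewrite ler_pdivrMr// mul1r.
  by move=> z Ez; split; apply: (mono _ (maxr M M')) => //; rewrite le_max lexx ?orbT.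
have [|[k c] [[/= Kk [Cc c1]] clz]] := compact_setX cK cS FF.
  by exists 1 => //= z [].
have CNc : asymptotic_cone O (- (c *m U)).
  apply: (asymptotic_cone_recession oO cO (z := k)) => t; rewrite le_eqVlt.
  move=> /predU1P[<-|t0].
    by rewrite scale0r addr0; exact/subset_closure/KO.
  have : [set z : 'rV[R]_n * 'rV[R]_d |
      closure O (1 *: z.1 + - t *: (z.2 *m U))] (k, c).
    apply: (cluster_closed clz (A := E t)).
    - by exists t.
    - apply: (@preimage_closed _ _
        (fun z : 'rV[R]_n * 'rV[R]_d => 1 *: z.1 + - t *: (z.2 *m U)));
        last exact: closed_closure.
      move=> z _; apply: lincomb_continuous; first by move=> ?; exact: cvg_fst.
      move=> w; apply: (@continuous_comp _ _ _ (@snd 'rV[R]_n 'rV[R]_d)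
          (fun c => c *m U) w).
        exact: cvg_snd.
      exact: mulmxr_continuous.
    - by move=> z [_ /=]; rewrite scale1r scaleNr scalemxAl.
  by rewrite /= scale1r scaleNr scalerN.
have cU0 := asymptotic_cone_pointed O0 nlO Cc CNc.
have c0 : c = 0 by apply: (row_free_inj fU); rewrite mul0mx.
by move: c1; rewrite c0 /= normr0 => /eqP; rewrite eq_sym oner_eq0.
Qed.

(** As [O] is open, a small step along [- e] is allowed near each [k], and compactness makes it
    uniform. For interior [e] this bounds the maximal heights over [K] away from 0. *)
Lemma lower_set_uniform (K : set 'rV[R]_n) e : compact K -> K `<=` O -> C e ->
  exists2 t : R, 0 < t & forall k, K k -> lower_set k (t *: e).
Proof.
move=> cK KO Ce.
have nearK : \forall t \near (0 : R)^'+, K `<=` [set k | O (k - t *: (e *m U))].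
  apply: (compact_near_coveringP K).1 => // k Kk.
  pose f (z : 'rV[R]_n * R) := 1 *: z.1 + -1 *: (z.2 *: (e *m U)).
  have cf : continuous f.
    apply: lincomb_continuous; first by move=> ?; exact: cvg_fst.
    move=> w; apply: (@continuous_comp _ _ _ (@snd 'rV[R]_n R)
      (fun t : R => t *: (e *m U)) w).
      exact: cvg_snd.
    exact: scalel_continuous.
  have : nbhs (k, 0 : R) (f @^-1` O).
    by apply: cf; apply: open_nbhs_nbhs; split => //=;
      rewrite /f/= scale1r scale0r scaler0 addr0; exact: KO.
  move=> [[P Q] /= [Pk Q0] PQ]; exists (P, Q) => /=.
    by split => //; exact: cvg_within.
  by move=> z /PQ; rewrite /f/= scale1r scaleN1r.
have [t /= t0 tK] : exists2 t : R, 0 < t & K `<=` [set k | O (k - t *: (e *m U))].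
  near (0 : R)^'+ => t; exists t; last by near: t.
  by near: t; exact: nbhs_right_gt.
exists t => // k /tK /= Ok; split.
  by case: coneC => _ _ _; apply => //; exact: ltW.
by rewrite -scalemxAl; exact: subset_closure.
Unshelve. all: by end_near. Qed.


Definition affine_symmetry (A : 'M[R]_n) (b : 'rV[R]_n) :=
  A \in unitmx /\ forall z, O z <-> O (z *m A + b).

Lemma affine_symmetryV A b : affine_symmetry A b ->
  affine_symmetry (invmx A) (- b *m invmx A).
Proof.
move=> [uA OA]; split; first by rewrite unitmx_inv.
move=> z; have := OA ((z - b) *m invmx A).
by rewrite -mulmxDl mulmxKV// subrK => -[? ?]; split.
Qed.

Lemma affine_symmetry_closure A b z : affine_symmetry A b ->
  closure O z -> closure O (z *m A + b).
Proof.
move=> [_ OA] Oz B.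
have cf : {for z, continuous (fun z : 'rV[R]_n => b + 1 *: (z *m A))}.
  apply: (@continuous_comp _ _ _ (fun z : 'rV[R]_n => z *m A)
    (fun y : 'rV[R]_n => b + 1 *: y) z).
    exact: mulmxr_continuous.
  exact: affine_continuous.
rewrite -[z *m A]scale1r addrC => /cf/Oz[z' [Oz' Bz']].
exists (b + 1 *: (z' *m A)); split => //.
by rewrite scale1r addrC; exact: (OA z').1.
Qed.

Lemma affine_symmetry_asymptotic A b v : affine_symmetry A b ->
  asymptotic_cone O v -> asymptotic_cone O (v *m A).
Proof.
move=> [uA OA] Cv y t Oy t0.
have yE : y = (y - b) *m invmx A *m A + b by rewrite mulmxKV// subrK.
rewrite yE addrAC scalemxAl -mulmxDl; apply: (OA _).1; apply: Cv => //.
by apply: (OA _).2; rewrite -yE.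
Qed.

Lemma affine_symmetry_span A b : affine_symmetry A b ->
  exists B : 'M[R]_d, U *m A = B *m U.
Proof.
move=> sA; apply/submxP/row_subP => i; rewrite row_mul.
have : lin_span (asymptotic_cone O) (row i U).
  by rewrite spanU; exists (delta_mx 0 i) => //; rewrite -rowE.
move=> [k [c [u [Cu ->]]]]; rewrite mulmx_suml; apply: summx_sub => j _.
rewrite -scalemxAl; apply: scalemx_sub.
have [w ->] := asymptotic_cone_mulmx (affine_symmetry_asymptotic sA (Cu j)).
exact: submxMl.
Qed.

(** A symmetry preserves the asymptotic cone, hence its span, where it acts by [B]; the inverse
    symmetry provides the inverse of [B]. *)
Lemma affine_symmetry_linear_part A b : affine_symmetry A b ->
  exists B : 'M[R]_d, [/\ B \in unitmx, U *m A = B *m U,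
    forall c, C c -> C (c *m B) & forall c, C c -> C (c *m invmx B)].
Proof.
move=> sA; have uA := sA.1; have sAV := affine_symmetryV sA.
have [B UB] := affine_symmetry_span sA.
have [B' UB'] := affine_symmetry_span sAV.
have BB' : B *m B' = 1%:M.
  apply: (row_free_inj fU); rewrite mul1mx -mulmxA -UB' mulmxA -UB.
  by rewrite mulmxK.
have [uB uB'] := mulmx1_unit BB'.
have B'E : invmx B = B' by rewrite -[invmx B]mulmx1 -BB' mulKmx.
exists B; split => // c Cc; rewrite /C/= ?B'E -mulmxA -?UB -?UB' mulmxA.
  exact: affine_symmetry_asymptotic sA Cc.
exact: affine_symmetry_asymptotic sAV Cc.
Qed.

Lemma lower_set_compact x : O x -> compact (lower_set x).
Proof.
move=> Ox; have xO : [set x] `<=` O by move=> _ ->.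
have [M M0 bM] := lower_set_bounded (@compact_set1 _ x) xO.
apply: bounded_closed_compact.
  exists M; split; first exact: num_real.
  by move=> N MN c xc; exact: le_trans (bM x c erefl xc) (ltW MN).
have [clC _ _ _] := coneC; apply: closedI => //.
apply: (@preimage_closed _ _ (fun c : 'rV[R]_d => x - c *m U));
  last exact: closed_closure.
move=> c _.
apply: (@continuous_comp _ _ _ (fun c : 'rV[R]_d => c *m U)
  (fun y : 'rV[R]_n => x - y) c).
  exact: mulmxr_continuous.
have -> : (fun y : 'rV[R]_n => x - y) = fun y => x + -1 *: y.
  by apply/funext => y; rewrite scaleN1r.
exact: affine_continuous.
Qed.

Hypothesis d_gt0 : (0 < d)%N.
Context (K : set 'rV[R]_n) (G : set ('rV[R]_n -> 'rV[R]_n)).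
Hypotheses (cK : compact K) (KO : K `<=` O) (gG : affine_subgroup G).
Hypothesis GO : forall g, G g -> g @` O = O.
Hypothesis GK : \bigcup_(g in G) (g @` K) = O.

Lemma exists_affine_symmetry y : O y ->
  exists A b, affine_symmetry A b /\ K (y *m A + b).
Proof.
case: gG => affG _ _ invG; rewrite -{1}GK => -[g Gg [k Kk gk]].
have [h [Gh gh hg]] := invG _ Gg.
have [A [b [uA hE]]] := affG _ Gh.
exists A, b; rewrite -hE -gk gh; split => //; split => // z.
rewrite -hE; split => [Oz|].
  by rewrite -(GO Gh); exists z.
by rewrite -{1}(GO Gh) => -[z' Oz' /(can_inj hg) <-].
Qed.

(** Here [B] is [s A_s] in coordinates, for a symmetry carrying [y_s] to [k] in [K]. The last clause
    follows the segment from [x - u] to [x + v], parametrized up to [1 / s]. *)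
Lemma rescaled_symmetry x u e (s : R) :
  O x -> lower_set x u ->
  (forall c, lower_set x c -> cone_height C c <= cone_height C u) ->
  (forall k, K k -> lower_set k e) -> 0 < s <= 1 ->
  exists k (B : 'M[R]_d), [/\ K k, forall c, C (c *m B) <-> C c,
    lower_set k (u *m B), cone_height C e <= cone_height C (u *m B) &
    forall v t, O (x + v *m U) -> 0 <= t -> t * s <= 1 ->
      closure O (k + (t *: (u + v) - u) *m B *m U)].
Proof.
move=> Ox [Cu xu] umax Ke /andP[s0 s1].
have [_ _ CD CZ] := coneC.
pose y := x - ((1 - s) *: u) *m U.
have Oy : O y.
  rewrite /y (_ : _ - _ = (1 - (1 - s)) *: x + (1 - s) *: (x - u *m U)).
    by apply: closure_segment => //; apply/andP; split; lra.
  by rewrite -scalemxAl scalerBr addrA -scalerDl subrK scale1r.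
(* If [c] is admissible at [y], then [c + (1 - s) u] is admissible at [x]; superadditivity and the
   maximality of [u] bound the height of [c]. *)
have umaxy c : lower_set y c -> cone_height C c <= s * cone_height C u.
  move=> [Cc yc]; have C1u : C ((1 - s) *: u) by apply: CZ => //; lra.
  have := umax (c + (1 - s) *: u); move: (cone_heightD C_ge0 Cc C1u).
  have : (1 - s) * cone_height C u <= cone_height C ((1 - s) *: u).
    by apply: cone_heightZ => //; lra.
  move=> h1 h2 h3; suff /h3 : lower_set x (c + (1 - s) *: u) by lra.
  split; first exact: CD.
  by rewrite mulmxDl [c *m U + _]addrC opprD addrA.
have [A [b [sA Kk]]] := exists_affine_symmetry Oy.
have [B [uB UB CB CBV]] := affine_symmetry_linear_part sA.
have [t t0 hB] := cone_height_unitmx C_ge0 d_gt0 uB CB CBV.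
set k := y *m A + b in Kk.
have move_k c : closure O (y + c *m U) -> closure O (k + c *m B *m U).
  move=> /(affine_symmetry_closure sA); rewrite mulmxDl -(mulmxA c U) UB mulmxA.
  by rewrite addrAC.
exists k, (s *: B); split => //.
- move=> c; rewrite -scalemxAr; split => Cc;
    last by apply: CZ; [exact: ltW|exact: CB].
  have : C (s^-1 *: (s *: (c *m B))) by apply: CZ => //; rewrite invr_ge0 ltW.
  by rewrite scalerA mulVf ?gt_eqF// scale1r => /CBV; rewrite mulmxK.
- rewrite -scalemxAr; split; first by apply: CZ; [exact: ltW|exact: CB].
  rewrite scalemxAl -mulNmx -mulNmx; apply: move_k.
  by rewrite mulNmx /y -addrA -opprD -mulmxDl -scalerDl subrK scale1r.
- have [Ce ke] := Ke _ Kk.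
  (* Pulled back by the symmetry, [e] competes with [s u] at [y]; both heights scale by the same
     [t]. *)
  have : lower_set y (e *m invmx B).
    split; first exact: CBV.
    have /(affine_symmetry_closure (affine_symmetryV sA)) := ke.
    congr (closure O _).
    rewrite -mulmxDl /k addrAC addrK mulmxBl mulmxK ?sA.1//; congr (_ - _).
    rewrite -[in LHS](mulmxKV uB e) -!mulmxA; do 2!congr (_ *m _).
    by rewrite mulmxA -UB mulmxK// sA.1.
  move=> /umaxy le1.
  have -> : e = e *m invmx B *m B by rewrite mulmxKV.
  rewrite hB; last exact: CBV.
  apply: (@le_trans _ _ (t * (s * cone_height C u))); first by rewrite ler_pM2l.
  rewrite mulrCA -hB// -scalemxAr cone_heightZ//; last exact: CB.
  exact: ltW.
- move=> v r Ov r0 rs; rewrite -scalemxAr scalemxAl; apply: move_k.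
  (* This is the point of parameter [r s] on the segment from [x - u] to [x + v]. *)
  have -> : y + s *: (r *: (u + v) - u) *m U
      = (1 - r * s) *: (x - u *m U) + (r * s) *: (x + v *m U).
    rewrite /y -!scalemxAl !mulmxDl mulNmx -!scalemxAl mulmxDl.
    by apply/rowP => i; rewrite !mxE; ring.
  apply: closure_convex => //; first exact: subset_closure.
  by rewrite mulr_ge0// ltW.
Qed.


(** The rescaled images of [u] and [u + v] cluster at some [a] interior to [C] and some [b] in [C].
    An image of [u + v] near [b] enters [C] once a small multiple of the image of [u] is added, and
    the rescaled maps reflect membership in [C]. *)
Lemma section_sub_translated_cone x (e : 'rV[R]_d) : O x -> nbhs e C ->
  exists u, [/\ C u, closure O (x - u *m U) &
    forall v, O (x + v *m U) -> C (u + v)].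
Proof.
move=> Ox nbe; have [clC _ CD CZ] := coneC.
have Ce := nbhs_singleton nbe.
have he : 0 < cone_height C e by exact: interior_cone_height_gt0.
have hZ t : 0 < t -> 0 < cone_height C (t *: e).
  move=> t0; apply: lt_le_trans (cone_heightZ C_ge0 (ltW t0) Ce).
  exact: mulr_gt0.
have xO : [set x] `<=` O by move=> _ ->.
have [t1 t1_gt0 /(_ x erefl) xt1] := lower_set_uniform (@compact_set1 _ x) xO Ce.
have [u xu umax] : exists2 u, lower_set x u &
    forall c, lower_set x c -> cone_height C c <= cone_height C u.
  apply: cone_height_max => //; [exact: lower_set_compact| |by move=> c []].
  by exists (t1 *: e).
have nbu : nbhs u C.
  apply: cone_height_gt0_interior => //; first exact: xu.1.
  exact: lt_le_trans (hZ _ t1_gt0) (umax _ xt1).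
exists u; split; [exact: xu.1|exact: xu.2|move=> v Ov].
have [M M0 KM] := lower_set_bounded cK KO.
have [t t0 Kt] := lower_set_uniform cK KO Ce.
have m0 := hZ _ t0; set m := cone_height C (t *: e) in m0.
(* Adding small multiples of [u + v] of either sign to the interior point [u] stays in [C]. As
   coordinates are nonnegative on [C], this bounds the images of [u + v] by those of [u]. *)
have [r r0 ruv] : exists2 r : R, 0 < r & forall s, `|s| <= r -> C (u + s *: (u + v)).
  have := @line_continuous R 'rV[R]_d u (u + v) 0; rewrite /continuous_at scale0r addr0.
  move=> /(_ _ nbu)/nbhs_ballP[r /= r0 rC]; exists (r / 2); first by rewrite divr_gt0.
  move=> s sr; apply: rC; rewrite -ball_normE /= sub0r normrN.
  by apply: le_lt_trans sr _; rewrite ltr_pdivrMr// ltr_pMr// ltr1n.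
pose S := [set c : 'rV[R]_d | `|c| <= M + M / r].
have cS : compact S.
  apply: bounded_closed_compact.
    exists (M + M / r); split; first exact: num_real.
    by move=> N MN c /= cM; exact: le_trans cM (ltW MN).
  apply: (@preimage_closed _ _ (fun c : 'rV[R]_d => `|c|) [set x | x <= M + M / r]).
    by move=> c _; exact: norm_continuous.
  exact: closed_le.
(* [E s] collects the triples (image of [y_s], rescaled [u], rescaled [u + v]). *)
pose E (s : R) (z : 'rV[R]_n * ('rV[R]_d * 'rV[R]_d)) := exists B : 'M[R]_d,
  [/\ z.2.1 = u *m B, z.2.2 = (u + v) *m B, forall c, C (c *m B) <-> C c &
   [/\ K z.1, C z.2.1 /\ m <= cone_height C z.2.1, S z.2.1, S z.2.2 &
    forall t, 0 <= t -> t * s <= 1 ->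
      closure O (z.1 + (t *: z.2.2 - z.2.1) *m U)]].
have E0 s : 0 < s <= 1 -> E s !=set0.
  move=> s01; have [k [B [Kk CB ku mu kuv]]] := rescaled_symmetry Ox xu umax Kt s01.
  exists (k, (u *m B, (u + v) *m B)), B; split => //=; split => //=.
  - by split => //; exact: ku.1.
  - by apply: le_trans (KM _ _ Kk ku) _; rewrite lerDl divr_ge0// ltW.
  - apply: (@le_trans _ _ (M / r)); last by rewrite lerDr ltW.
    apply: mx_norm_le => [|i j]; first by rewrite divr_ge0// ltW.
    rewrite ord1 ler_pdivlMr// mulrC -[X in X * _](gtr0_norm r0) -normrM.
    have le q : `|q| <= r -> 0 <= (u *m B) 0 j + q * ((u + v) *m B) 0 j.
      move=> /ruv/CB/C_ge0/(_ j); rewrite mulmxDl -scalemxAl; congr (0 <= _).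
      by rewrite mxE; congr (_ + _); rewrite mxE.
    have uM : (u *m B) 0 j <= M.
      exact: le_trans (le_trans (ler_norm _) (mx_entry_le_norm _ _ _)) (KM _ _ Kk ku).
    have rr : `|r| <= r by rewrite gtr0_norm.
    have rNr : `|- r| <= r by rewrite normrN gtr0_norm.
    have := le _ rr; have := le _ rNr.
    by rewrite mulNr => h1 h2; rewrite ler_norml; apply/andP; split; lra.
  - by move=> q q0 qs; rewrite scalemxAl -mulmxBl; exact: kuv.
(* The limit as [s] tends to 0; allowing every [s' <= s] makes the base sets nested. *)
pose F := filter_from [set s : R | 0 < s <= 1]
  (fun s => [set z | exists2 s', 0 < s' <= s & E s' z]).
have FF : ProperFilter F.
  apply: filter_from_proper; last first.
    move=> s /andP[s0 s1]; have [|z Ez] := E0 s; first by rewrite s0.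
    by exists z, s => //; rewrite s0/=.
  apply: filter_from_filter; first by exists 1 => /=; rewrite ltr01 lexx.
  move=> s s' /andP[s0 s1] /andP[s'0 s'1]; exists (minr s s') => /=.
    by rewrite lt_min s0 s'0/= ge_min s1.
  by move=> z [q]; rewrite le_min => /and3P[q0 qs qs'] Ez; split; exists q => //;
    rewrite q0.
have [|[k [a b]] [_ clz]] := compact_setX cK (compact_setX cS cS) FF.
  exists 1 => /=; first by rewrite ltr01 lexx.
  by move=> z [s _ [B [_ _ _ [Kz _ S1 S2 _]]]].
have F1 : F [set z | exists2 s', 0 < s' <= 1 & E s' z].
  by exists 1 => /=; rewrite ?ltr01 ?lexx.
have c1 : continuous (fun z : 'rV[R]_n * ('rV[R]_d * 'rV[R]_d) => z.2.1).
  by move=> z; apply: (@continuous_comp _ _ _ (@snd 'rV[R]_n ('rV[R]_d * 'rV[R]_d)%type)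
    (@fst 'rV[R]_d 'rV[R]_d) z); [exact: cvg_snd|exact: cvg_fst].
have c2 : continuous (fun z : 'rV[R]_n * ('rV[R]_d * 'rV[R]_d) => z.2.2).
  by move=> z; apply: (@continuous_comp _ _ _ (@snd 'rV[R]_n ('rV[R]_d * 'rV[R]_d)%type)
    (@snd 'rV[R]_d 'rV[R]_d) z); [exact: cvg_snd|exact: cvg_snd].
have [Ca ma] : C a /\ m <= cone_height C a.
  have cl := @closed_cone_height_ge _ _ _ coneC C_ge0 m.
  apply: (cluster_closed clz F1
    (B := [set z | C z.2.1 /\ m <= cone_height C z.2.1])).
    by apply: (@preimage_closed _ _ _ _ _ cl) => z _; exact: c1.
  by move=> z [s _ [B [_ _ _ []]]].
have nba : nbhs a C.
  by apply: cone_height_gt0_interior => //; exact: lt_le_trans ma.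
(* For each [q >= 0], once [q s <= 1] the closure contains the points approximating
   [k + (q b - a) U], so it contains a ray of direction [b U]. *)
have Cb : C b.
  apply: (asymptotic_cone_recession oO cO (z := k - a *m U)) => q q0.
  have -> : k - a *m U + q *: (b *m U) = 1 *: k + 1 *: ((q *: b + -1 *: a) *m U).
    by rewrite !scale1r scaleN1r mulmxBl -scalemxAl addrAC addrA.
  have q1 : 0 < q + 1 by rewrite ltr_wpDl.
  apply: (cluster_closed clz (A := [set z | exists2 s', 0 < s' <= (q + 1)^-1 & E s' z])
    (B := [set z | closure O (1 *: z.1 + 1 *: ((q *: z.2.2 + -1 *: z.2.1) *m U))])).
  - by exists (q + 1)^-1 => //=; rewrite invr_gt0 q1/= invf_le1// lerDr.
  - apply: (@preimage_closed _ _ (fun z : 'rV[R]_n * ('rV[R]_d * 'rV[R]_d) =>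
      1 *: z.1 + 1 *: ((q *: z.2.2 + -1 *: z.2.1) *m U)));
      last exact: closed_closure.
    move=> z _; apply: lincomb_continuous; first by move=> ?; exact: cvg_fst.
    move=> w; apply: (@continuous_comp _ _ _
      (fun z : 'rV[R]_n * ('rV[R]_d * 'rV[R]_d) => q *: z.2.2 + -1 *: z.2.1)
      (fun c => c *m U) w); last exact: mulmxr_continuous.
    exact: lincomb_continuous.
  - move=> z [s /andP[s0 sq] [B [_ _ _ [_ _ _ _ /(_ q q0)]]]] /=.
    rewrite !scale1r scaleN1r; apply.
    apply: (@le_trans _ _ (q * (q + 1)^-1)); first by rewrite ler_wpM2l.
    by rewrite ler_pdivrMr// mul1r lerDl.
(* The small difference between the image of [u + v] and [b] is absorbed by [q] times the image of
   [u], which is near the interior point [a]; [CB] then pulls membership back. *)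
have Cq q : 0 < q -> C (u + v + q *: u).
  move=> q0; pose f (z : 'rV[R]_n * ('rV[R]_d * 'rV[R]_d)) :=
    1 *: z.2.1 + q^-1 *: (z.2.2 + - b).
  have cf : continuous f.
    apply: lincomb_continuous => // z.
    by apply: (@cvgB _ _ _ (nbhs z)); [exact: c2|exact: cvg_cst].
  have : nbhs (k, (a, b)) (f @^-1` C).
    by apply: cf; rewrite /f /= subrr scaler0 addr0 scale1r.
  move=> /(clz _ _ F1)[[k' [a' b']] [[s _ [B [/= -> -> CB _]]]]].
  rewrite /f /= scale1r => Cf; apply/CB; rewrite mulmxDl -scalemxAl.
  have -> : (u + v) *m B + q *: (u *m B)
      = b + q *: (u *m B + q^-1 *: ((u + v) *m B - b)).
    move: (u *m B) ((u + v) *m B) => g h.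
    by apply/rowP => i; rewrite !mxE; field; rewrite gt_eqF.
  by apply: CD => //; apply: CZ => //; exact: ltW.
have cl := cvg_at_right_filter (@line_continuous R 'rV[R]_d (u + v) u 0).
rewrite scale0r addr0 in cl.
apply: (closed_cvg _ clC _ _ cl); near=> q; apply: Cq.
by near: q; exact: nbhs_right_gt.
Unshelve. all: by end_near. Qed.

End quasi_homogeneous_section.

(** * Both inclusions between the closed section and the translated cone *)

Theorem theorem4p3 (R : realType) (n : nat) (O : set 'rV[R]_n) :
  affine_domain O -> properly_convex O -> quasi_homogeneous O ->
  forall x : 'rV[R]_n, O x ->
    exists p : 'rV[R]_n,
      closure (O `&` [set x + l | l in lin_span (asymptotic_cone O)])
      = [set p + u | u in asymptotic_cone O].
Proof.
move=> [oO _] [cO nlO] [K [G [cK KO gG GO GK]]] x Ox.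
have O0 : O !=set0 by exists x.
have coneA := asymptotic_cone_closed_cone oO cO O0.
have [d [U [fU spanU ge0U [e nbe]]]] := closed_cone_coordinates coneA
  (fun v => asymptotic_cone_pointed O0 nlO).
have [u [Cu xu uv]] : exists u : 'rV[R]_d, [/\ asymptotic_cone O (u *m U),
    closure O (x - u *m U) &
    forall v, O (x + v *m U) -> asymptotic_cone O ((u + v) *m U)].
  (* When the cone is trivial, [u = 0] works; the height argument runs in positive dimension. *)
  have [d0|d0] := posnP d.
    subst d; exists 0; rewrite mul0mx subr0; case: coneA => _ A0 _ _.
    split => //; first exact: subset_closure.
    by move=> v _; rewrite [v]thinmx0 addr0 mul0mx.
  exact: section_sub_translated_cone d0 _ _ cK KO gG GO GK _ _ Ox nbe.
exists (x - u *m U); apply/seteqP; split.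
  (* The translated cone is closed, so it is enough to treat points of the section itself. *)
  have clD : closed [set x - u *m U + c | c in asymptotic_cone O].
    have -> : [set x - u *m U + c | c in asymptotic_cone O]
        = (fun z => - (x - u *m U) + 1 *: z) @^-1` asymptotic_cone O.
      apply/seteqP; split => [_ [c Cc <-]|z Cz] /=.
        by rewrite scale1r addKr.
      by exists (- (x - u *m U) + 1 *: z) => //; rewrite scale1r addNKr.
    case: coneA => clA _ _ _; apply: preimage_closed => // z _.
    exact: affine_continuous.
  move=> z clz; apply: clD; apply: closureS clz => y [Oy [l]].
  rewrite spanU => -[v _ <-] yE; rewrite -yE in Oy *.
  by exists ((u + v) *m U); [exact: uv|rewrite mulmxDl addrA subrK].
move=> _ [c Cc <-]; have [w cE] := asymptotic_cone_mulmx spanU Cc.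
set z := x - u *m U + c.
have clz : closure O z.
  by rewrite /z -[c]scale1r; exact: closure_add_asymptotic.
(* The point [z] is in the closure of [O] but must be approached within the section: moving slightly
   from [z] towards [x] enters [O] and stays in [x + L]. *)
have cz := cvg_at_right_filter (@line_continuous R 'rV[R]_n z (x - z) 0).
rewrite scale0r addr0 in cz.
apply: (closed_cvg _ (@closed_closure _ _) _ _ cz); near=> t.
have t0 : 0 < t by near: t; exact: nbhs_right_gt.
have t1 : t < 1 by near: t; exact: nbhs_right_lt.
apply: subset_closure; split.
  have -> : z + t *: (x - z) = (1 - (1 - t)) *: x + (1 - t) *: z.
    by apply/rowP => i; rewrite !mxE; ring.
  by apply: closure_segment => //; apply/andP; split; lra.
rewrite spanU; exists (((1 - t) *: (w - u)) *m U); first by exists ((1 - t) *: (w - u)).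
by rewrite /z cE -scalemxAl mulmxBl; apply/rowP => i; rewrite !mxE; ring.
Unshelve. all: by end_near. Qed.
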